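(* Let $V<C<M$ be real numbers and let $0\le p_1\le p_2\le p_3\le p_4\le 1$, $\tilde p=(p_1,p_2,p_3,p_4)$. For $\beta\in[0,1]$ let $X_{\tilde p,\beta}$ be a random variable with cumulative distribution function $F_{\tilde p,\beta}(x)=\frac12H(x)+(1-\beta)(J(x)-H(x))$, and let $Q^*_{\tilde p,\beta}=F_{\tilde p,\beta}^{-1}\left(\frac{M-C}{M-V}\right)$, with $H,J$ as defined in the context. Then the profit expectation $\mathbb{E}[\pi(X_{\tilde p,\beta})]$ evaluated at the order quantity $Q=Q^*_{\tilde p,\beta}$ is an increasing function of the risk factor $\beta\in[0,1]$.
   Context: $C$ is the unit purchase cost, $M$ the unit selling price, $V$ the unit salvage value, $Q$ the order quantity. For order quantity $Q$, the newsvendor profit for demand $x$ is $\pi(x)=(M-V)x+(V-C)Q$ if $x\le Q$ and $\pi(x)=(M-C)Q$ if $x>Q$. For a demand $X$ with density $f_X$, the profit expectation, as a function of $Q$, is $\mathbb{E}[\pi(X)](Q)=\int_{-\infty}^Q\big((M-V)x+(V-C)Q\big)f_X(x)\,dx+\int_Q^\infty(M-C)Q\,f_X(x)\,dx$. For $i=1,2$, $F_i$ is the cumulative distribution function of the normal distribution with mean $\mu_i\in\mathbb{R}$ and standard deviation $\sigma_i>0$. Constants: $P_1=\frac{p_1p_3}{3}+\frac{2p_2p_3}{3}+\frac{2p_1p_4}{3}+\frac{p_2p_4}{3}$, $P_2=\frac{p_1+p_2+p_3+p_4}{2}-\frac{p_1p_3}{3}-\frac{2p_1p_4}{3}-\frac{2p_2p_3}{3}-\frac{p_2p_4}{3}$,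 $P_3=2-(p_1+p_2+p_3+p_4)+\frac{p_1p_3}{3}+\frac{2p_1p_4}{3}+\frac{2p_2p_3}{3}+\frac{p_2p_4}{3}$. Functions: $H(x)=P_1F_1(x)^2+2P_2F_1(x)F_2(x)+P_3F_2(x)^2$, $J(x)=P_1F_1(x)+P_2(F_1(x)+F_2(x))+P_3F_2(x)$. For every $\beta\in[0,1]$, $F_{\tilde p,\beta}$ is a cumulative distribution function having a density, and $F_{\tilde p,\beta}^{-1}(y)$ denotes the unique real $x$ with $F_{\tilde p,\beta}(x)=y$, for $y\in(0,1)$. *)

(* Defs.v *)
From HB Require Import structures.
From mathcomp Require Import all_boot all_order all_algebra.
From mathcomp Require Import all_classical all_reals all_analysis.

Set Implicit Arguments.
Unset Strict Implicit.
Unset Printing Implicit Defensive.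

Import Order.TTheory GRing.Theory Num.Theory.
Import numFieldNormedType.Exports.

Local Open Scope classical_set_scope.
Local Open Scope ring_scope.

Definition profit_expectation (R : realType) (C M V : R) (f : R -> R) (Q : R)
    : \bar R :=
  (\int[lebesgue_measure]_(x in `]-oo, Q])
      (((M - V) * x + (V - C) * Q) * f x)%:E +
   \int[lebesgue_measure]_(x in `]Q, +oo[) ((M - C) * Q * f x)%:E)%E.

Definition is_density (d : measure_display) (T : measurableType d)
    (R : realType) (P : probability T R) (X : {RV P >-> R}) (f : R -> R)
    : Prop :=
  [/\ measurable_fun setT f, forall x, 0 <= f x &
      forall A : set R, measurable A ->
        distribution P X A = (\int[lebesgue_measure]_(x in A) (f x)%:E)%E].

(* The second parameter of [normal_prob] is the standard deviation. *)
Definition normal_cdf (R : realType) (mu sigma x : R) : R :=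
  fine (normal_prob mu sigma `]-oo, x]).

(* The [x] with [F x = y] when it exists uniquely; unspecified otherwise. *)
Definition inv_cdf (R : realType) (F : R -> R) (y : R) : R :=
  xget 0 [set x | F x = y].

Definition coefP1 (R : realType) (p1 p2 p3 p4 : R) : R :=
  p1 * p3 / 3 + 2 * p2 * p3 / 3 + 2 * p1 * p4 / 3 + p2 * p4 / 3.

Definition coefP2 (R : realType) (p1 p2 p3 p4 : R) : R :=
  (p1 + p2 + p3 + p4) / 2 - p1 * p3 / 3 - 2 * p1 * p4 / 3
  - 2 * p2 * p3 / 3 - p2 * p4 / 3.

Definition coefP3 (R : realType) (p1 p2 p3 p4 : R) : R :=
  2 - (p1 + p2 + p3 + p4) + p1 * p3 / 3 + 2 * p1 * p4 / 3
  + 2 * p2 * p3 / 3 + p2 * p4 / 3.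

Definition mixH (R : realType) (p1 p2 p3 p4 : R) (F1 F2 : R -> R) (x : R) : R :=
  coefP1 p1 p2 p3 p4 * F1 x ^+ 2 + 2 * coefP2 p1 p2 p3 p4 * F1 x * F2 x
  + coefP3 p1 p2 p3 p4 * F2 x ^+ 2.

Definition mixJ (R : realType) (p1 p2 p3 p4 : R) (F1 F2 : R -> R) (x : R) : R :=
  coefP1 p1 p2 p3 p4 * F1 x + coefP2 p1 p2 p3 p4 * (F1 x + F2 x)
  + coefP3 p1 p2 p3 p4 * F2 x.

Definition mixF (R : realType) (p1 p2 p3 p4 : R) (F1 F2 : R -> R) (beta x : R)
    : R :=
  mixH p1 p2 p3 p4 F1 F2 x / 2
  + (1 - beta) * (mixJ p1 p2 p3 p4 F1 F2 x - mixH p1 p2 p3 p4 F1 F2 x).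

(* Main.v *)
(* With c = (M - C) / (M - V), exchanging the order of integration turns the
   expected profit into
     phi_beta(Q) = (M - C) Q - (M - V) I_beta(Q),
     I_beta(Q) = \int_{-oo}^Q F_beta.
   Since J - H = P1 F1 (1 - F1) + P2 (F1 (1 - F2) + F2 (1 - F1))
   + P3 F2 (1 - F2) is positive everywhere, F_beta is strictly decreasing in
   beta, so phi_beta(Q) is strictly increasing in beta for each fixed Q.  As
   F_beta is nondecreasing, I_beta is convex, with tangent slope c at
   Q*_beta: hence Q*_beta maximizes phi_beta, and
     phi_beta2(Q*_beta2) >= phi_beta2(Q*_beta1) > phi_beta1(Q*_beta1).  *)
Require Import Defs.
From HB Require Import structures.
From mathcomp Require Import all_boot all_order all_algebra.
From mathcomp Require Import all_classical all_reals all_analysis.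
From mathcomp Require Import measurable_realfun ring lra.

Import Order.TTheory GRing.Theory Num.Theory.
Import numFieldNormedType.Exports.

Local Open Scope classical_set_scope.
Local Open Scope ring_scope.

(** * Strict positivity and strict monotonicity of integrals *)

(** A nonnegative function with zero integral vanishes almost everywhere; as [f] vanishes nowhere on
    [D], the set [D] itself would be null. *)
Lemma integral_gt0 {d : measure_display} {T : measurableType d} {R : realType}
    (mu : {measure set T -> \bar R}) (D : set T) (f : T -> \bar R) :
  measurable D -> measurable_fun D f -> (forall x, D x -> 0 < f x)%E ->
  (0 < mu D)%E -> (0 < \int[mu]_(x in D) f x)%E.
Proof.
move=> mD mf f0 D0; have f0' x : D x -> (0 <= f x)%E by move=> /f0/ltW.
rewrite lt0e integral_ge0// andbT; apply/eqP => I0.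
have : (\int[mu]_(x in D) `|f x| = 0)%E.
  rewrite -I0; apply: eq_integral => x /[!inE] Dx.
  by rewrite gee0_abs// f0'.
move/(ae_eq_integral_abs mu mD mf) => [N [mN N0 DN]].
have : (mu D <= mu N)%E.
  rewrite le_measure ?inE// => x Dx; apply: DN => /= /(_ Dx) fx0.
  by have := f0 _ Dx; rewrite fx0 ltxx.
by rewrite N0 leNgt D0.
Qed.

(** Split [g] as [f + (g - f)]: the second summand has positive integral, and adding it is a strict
    increase because the integral of [f] is finite. *)
Lemma ge0_lt_integral {d : measure_display} {T : measurableType d}
    {R : realType} (mu : {measure set T -> \bar R}) (D : set T) (f g : T -> R) :
  measurable D -> measurable_fun D f -> measurable_fun D g ->
  (forall x, D x -> 0 <= f x < g x) -> (0 < mu D)%E ->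
  (\int[mu]_(x in D) (f x)%:E < +oo)%E ->
  (\int[mu]_(x in D) (f x)%:E < \int[mu]_(x in D) (g x)%:E)%E.
Proof.
move=> mD mf mg fg D0 foo.
have -> : (\int[mu]_(x in D) (g x)%:E =
    \int[mu]_(x in D) ((f x)%:E + (g x - f x)%:E))%E.
  by apply: eq_integral => x _; rewrite -EFinD addrC subrK.
have mgf : measurable_fun D (fun x => (g x - f x)%:E).
  by apply/measurable_EFinP; exact: measurable_funB.
rewrite ge0_integralD//; last 3 first.
- by move=> x /fg/andP[+ _]; rewrite lee_fin.
- exact/measurable_EFinP.
- by move=> x /fg/andP[_ /ltW]; rewrite lee_fin subr_ge0.
rewrite lteDl.
  by apply: integral_gt0 => // x /fg/andP[_]; rewrite lte_fin subr_gt0.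
rewrite ge0_fin_numE// integral_ge0// => x /fg/andP[+ _].
by rewrite lee_fin.
Qed.

(** * Partial moments as iterated integrals *)

(** [Q - x] is the length of [[x, Q]], so both sides integrate [f x] over the region [x <= t <= Q],
    in the two orders allowed by Tonelli. *)
Lemma integral_partial_moment {R : realType} (f : R -> R) (Q : R) :
  measurable_fun setT f -> (forall x, 0 <= f x) ->
  (\int[lebesgue_measure]_(x in `]-oo, Q]) ((Q - x) * f x)%:E =
   \int[lebesgue_measure]_(t in `]-oo, Q])
     \int[lebesgue_measure]_(x in `]-oo, t]) (f x)%:E)%E.
Proof.
move=> mf f0.
pose A : set (R * R) := [set z | z.1 <= z.2] `&` [set z | z.2 <= Q].
have mA : measurable A.
  apply: measurableI.
    rewrite -[X in measurable X]setTI.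
    exact: measurable_fun_le.
  rewrite -[X in measurable X]setTI.
  exact: measurable_fun_le.
pose g (z : R * R) := (f z.1 * \1_A z)%:E.
have mg : measurable_fun setT g.
  apply/measurable_EFinP; apply: measurable_funM; last exact: measurable_indic.
  exact: measurableT_comp.
have g0 z : (0 <= g z)%E by rewrite lee_fin mulr_ge0.
transitivity (\int[lebesgue_measure]_x \int[lebesgue_measure]_t g (x, t))%E.
  rewrite integral_mkcond; apply: eq_integral => x _; rewrite patchE.
  rewrite /g/=.
  under eq_integral do rewrite EFinM.
  rewrite ge0_integralZl//=; last 2 first.
    apply/measurable_EFinP; apply: measurableT_comp; last exact: pair1_measurable.
    exact: measurable_indic.
    by rewrite lee_fin.
  have -> : (\int[lebesgue_measure]_t (\1_A (x, t))%:E)%E = lebesgue_measure `[x, Q]%classic.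
    rewrite -[X in _ = lebesgue_measure X]setIT -integral_indic//; apply: eq_integral => t _.
    congr (_%:E); rewrite !indicE; congr (_%:R); congr nat_of_bool.
    apply/idP/idP; rewrite !inE/= /A/= in_itv/=; first by move=> [-> ->].
    by move=> /andP[].
  rewrite mem_setE in_itv/= lebesgue_measure_itv/= lte_fin.
  have [xQ|Qx|->] := ltgtP x Q; last by rewrite subrr mul0r mule0.
    by rewrite -EFinB -EFinM mulrC.
  by rewrite mule0.
rewrite fubini_tonelli// [RHS]integral_mkcond.
apply: eq_integral => t _; rewrite patchE mem_setE in_itv/=.
have [tQ|Qt] := leP t Q.
  rewrite [RHS]integral_mkcond; apply: eq_integral => x _.
  rewrite patchE mem_setE in_itv/= /g/= indicE.
  have [xt|tx] := leP x t.
    by rewrite mem_set ?mulr1.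
  by rewrite memNset ?mulr0//= => -[/= /(lt_le_trans tx)]; rewrite ltxx.
apply: integral0_eq => x _; rewrite /g indicE memNset ?mulr0//= => -[_ /=].
by rewrite leNgt Qt.
Qed.

(** * The normal distribution function: bounds, continuity, integrability at minus infinity *)

Lemma normal_cdfE {R : realType} (m s x : R) :
  ((normal_cdf m s x)%:E =
   \int[lebesgue_measure]_(t in `]-oo, x]) (normal_pdf m s t)%:E)%E.
Proof. by rewrite /normal_cdf fineK// fin_num_measure. Qed.

Lemma normal_pdf_gt0 {R : realType} (m s x : R) : 0 < s ->
  0 < normal_pdf m s x.
Proof.
move=> s0; rewrite normal_pdfE ?gt_eqF// mulr_gt0 ?expR_gt0//.
by rewrite normal_peak_gt0 ?gt_eqF.
Qed.

Lemma measurable_EFin_normal_pdf {R : realType} (m s : R) (D : set R) :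
  measurable_fun D (fun x => (normal_pdf m s x)%:E).
Proof.
apply/measurable_EFinP/measurable_funTS; exact: measurable_normal_pdf.
Qed.

Lemma normal_prob_itv_gt0 {R : realType} (m s : R) (i : interval R) :
  0 < s -> (0 < (lebesgue_measure [set` i] : \bar R))%E ->
  (0 < normal_prob m s [set` i])%E.
Proof.
move=> s0 i0; apply: integral_gt0 => //.
  exact: measurable_EFin_normal_pdf.
by move=> x _; rewrite lte_fin normal_pdf_gt0.
Qed.

Lemma normal_cdf_gt0 {R : realType} (m s x : R) : 0 < s ->
  0 < normal_cdf m s x.
Proof.
move=> s0; rewrite fine_gt0// ltey_eq fin_num_measure//= andbT.
by rewrite normal_prob_itv_gt0// lebesgue_measure_itv/= ltNyr addey.
Qed.

Lemma normal_cdf_lt1 {R : realType} (m s x : R) : 0 < s ->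
  normal_cdf m s x < 1.
Proof.
move=> s0; rewrite -lte_fin /normal_cdf fineK ?fin_num_measure//.
rewrite -(probability_setT (normal_prob m s)) -(itv_setU_setT false x).
rewrite [ltRHS]measureU//=; last first.
  by rewrite -subset0 => z /=; rewrite !in_itv/= => -[]; rewrite andbT; case: ltP.
rewrite lteDl ?fin_num_measure// normal_prob_itv_gt0//.
by rewrite lebesgue_measure_itv/= ltry addye.
Qed.

(** The difference is the mass of []x, y]], and the density never exceeds its peak. *)
Lemma normal_cdf_lipschitz {R : realType} (m s x y : R) : 0 < s -> x <= y ->
  0 <= normal_cdf m s y - normal_cdf m s x <= normal_peak s * (y - x).
Proof.
move=> s0 xy.
have -> : normal_cdf m s y - normal_cdf m s x =
    fine (normal_prob m s `]x, y]).
  rewrite /normal_cdf (@itv_bndbnd_setU _ _ _ (BRight x))//=.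
  rewrite measureU//=; last first.
    by rewrite -subset0 => z /=; rewrite !in_itv/= => -[zx]; rewrite ltNge zx.
  by rewrite fineD ?fin_num_measure// addrC addKr.
rewrite fine_ge0//= -lee_fin fineK ?fin_num_measure//.
have -> : ((normal_peak s * (y - x))%:E =
    \int[lebesgue_measure]_(z in `]x, y]) (normal_peak s)%:E)%E.
  rewrite integral_cst//= lebesgue_measure_itv/= lte_fin.
  have [_|yx] := ltP x y; first by rewrite -EFinB -EFinM.
  by rewrite (@le_anti _ _ x y) ?xy ?yx// subrr mulr0 mule0.
apply: ge0_le_integral => //=.
- by move=> z _; rewrite lee_fin normal_pdf_ge0.
- exact: measurable_EFin_normal_pdf.
- by move=> z _; rewrite lee_fin normal_pdf_ub ?gt_eqF.
Qed.

Lemma continuous_normal_cdf {R : realType} (m s : R) : 0 < s ->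
  continuous (normal_cdf m s).
Proof.
move=> s0 x; apply/cvgrPdist_le => e e0.
have p0 : 0 < normal_peak s by rewrite normal_peak_gt0 ?gt_eqF.
have lip y : `|normal_cdf m s x - normal_cdf m s y| <= normal_peak s * `|x - y|.
  wlog xy : x y / x <= y.
    by move=> h; have [/h//|/ltW/h] := leP x y; rewrite distrC (distrC y).
  have /andP[h0 h1] := normal_cdf_lipschitz m s x y s0 xy.
  by rewrite distrC ger0_norm// (distrC x) ger0_norm// subr_ge0.
near=> y.
rewrite (le_trans (lip y))// mulrC -ler_pdivlMr// ltW//.
by near: y; exists (e / normal_peak s) => //=; rewrite divr_gt0.
Unshelve. all: by end_near. Qed.

(* Doubling the standard deviation leaves a factor [expR u], u quadratic in x,
   that absorbs the linear factor. *)
Lemma normal_pdf_moment_dominated {R : realType} (m s Q : R) : 0 < s ->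
  exists2 k, 0 <= k &
    forall x, (Q - x) * normal_pdf m s x <= k * normal_pdf m (2 * s) x.
Proof.
move=> s0; have s20 : 0 < 2 * s by rewrite mulr_gt0.
(* The exponents for [s] and [2 * s] differ by [(x - m)^2 / (2 s^2) - (x - m)^2 / (8 s^2)], which is
   [(x - m)^2 / c], the [u] below. *)
pose c := 8 * s ^+ 2 / 3.
have c0 : 0 <= c by apply: divr_ge0 => //; apply: mulr_ge0 => //; exact: sqr_ge0.
have p0 : 0 < normal_peak (2 * s) by rewrite normal_peak_gt0 ?gt_eqF.
(* The first factor bounds [(Q - x) / expR u]; the quotient of peaks converts the normalizing
   constants. *)
exists ((`|Q - m| + 1 + c) * normal_peak s / normal_peak (2 * s)).
  by rewrite mulr_ge0 ?invr_ge0 ?(ltW p0)// mulr_ge0 ?normal_peak_ge0// !addr_ge0.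
move=> x; rewrite !normal_pdfE ?gt_eqF//.
pose u := (x - m) ^+ 2 * 3 / (8 * s ^+ 2).
have u0 : 0 <= u 
  by apply: divr_ge0; apply: mulr_ge0 => //; exact: sqr_ge0.
have -> : normal_fun m (2 * s) x = expR u * normal_fun m s x.
  rewrite /normal_fun -expRD; congr expR; rewrite /u.
  by field; rewrite gt_eqF.
have eu : 1 + u <= expR u by exact: expR_ge1Dx.
(* With [a] the absolute value of [Q - m]: [Q - x <= a + 1 + (x - m)^2 = a + 1 + c * u <= (a + 1 +
   c) * (1 + u)]. *)
have Qx : Q - x <= (`|Q - m| + 1 + c) * expR u.
  have cu : c * u = (x - m) ^+ 2 by rewrite /c /u; field; rewrite gt_eqF.
  have : Q - m <= `|Q - m| := ler_norm _.
  set a := `|Q - m|; have a0 : 0 <= a := normr_ge0 _.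
  have ay : - (x - m) <= 1 + (x - m) ^+ 2.
    by have := sqr_ge0 ((x - m) + 1 / 2); nra.
  have : (a + 1 + c) * (1 + u) <= (a + 1 + c) * expR u.
    by rewrite ler_wpM2l// !addr_ge0.
  have := mulr_ge0 a0 u0.
  nra.
rewrite [leRHS](_ : _ = (`|Q - m| + 1 + c) * expR u *
    (normal_peak s * normal_fun m s x)); last by field; rewrite gt_eqF.
by rewrite ler_wpM2r// mulr_ge0 ?normal_peak_ge0 ?normal_fun_ge0.
Qed.

Lemma measurable_normal_cdf {R : realType} (m s : R) : 0 < s ->
  measurable_fun setT (normal_cdf m s).
Proof.
by move=> s0; apply: continuous_measurable_fun; exact: continuous_normal_cdf.
Qed.

(** The integral is a partial moment of the density, dominated by a multiple of the normal density
    of deviation [2 * s], which has finite mass. *)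
Lemma integral_normal_cdf_lty {R : realType} (m s Q : R) : 0 < s ->
  (\int[lebesgue_measure]_(t in `]-oo, Q]) (normal_cdf m s t)%:E < +oo)%E.
Proof.
move=> s0; under eq_integral do rewrite normal_cdfE.
rewrite -integral_partial_moment; [|exact: measurable_normal_pdf|]; last first.
  by move=> x; exact: normal_pdf_ge0.
have [k k0 kP] := normal_pdf_moment_dominated m s Q s0.
apply: (@le_lt_trans _ _ (\int[lebesgue_measure]_(x in `]-oo, Q])
    (k%:E * (normal_pdf m (2 * s) x)%:E))%E).
  apply: ge0_le_integral => //=.
  - move=> x; rewrite in_itv/= => xQ.
    by rewrite lee_fin mulr_ge0 ?normal_pdf_ge0// subr_ge0.
  - apply/measurable_EFinP; apply: measurable_funM.
      exact: measurable_funB.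
    apply/measurable_EFinP; exact: measurable_EFin_normal_pdf.
  - apply: measurable_funeM; exact: measurable_EFin_normal_pdf.
  - by move=> x _; rewrite -EFinM lee_fin.
rewrite ge0_integralZl_EFin//=.
- by rewrite -normal_cdfE -EFinM ltry.
- by move=> x _; rewrite lee_fin normal_pdf_ge0.
- exact: measurable_EFin_normal_pdf.
Qed.

(** * Expected profit in terms of the distribution function, and convexity of its integral *)

(** Below [Q] the profit is [(M - C) * Q - (M - V) * (Q - x)]. The constant term is thus integrated
    against total mass [G Q + (1 - G Q) = 1], and the rest is the partial moment [I]. *)
Lemma profit_expectationE {R : realType} (C M V Q I : R) (f G : R -> R) :
  measurable_fun setT f -> (forall x, 0 <= f x) ->
  (forall t, \int[lebesgue_measure]_(x in `]-oo, t]) (f x)%:E = (G t)%:E)%E ->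
  (\int[lebesgue_measure]_(x in `]Q, +oo[) (f x)%:E = (1 - G Q)%:E)%E ->
  (\int[lebesgue_measure]_(t in `]-oo, Q]) (G t)%:E = I%:E)%E ->
  profit_expectation C M V f Q = ((M - C) * Q - (M - V) * I)%:E.
Proof.
move=> mf f0 fG fGQ GI.
have Qf : (\int[lebesgue_measure]_(x in `]-oo, Q]) ((Q - x) * f x)%:E = I%:E)%E.
  by rewrite integral_partial_moment// -GI; apply: eq_integral => t _.
have mfE D : measurable_fun D (EFin \o f).
  by apply/measurable_EFinP/measurable_funTS.
(* The profit can take either sign, so linearity of the integral is applied through
   integrability. *)
have If D c : measurable D -> (\int[lebesgue_measure]_(x in D) (f x)%:E = c%:E)%E ->
    lebesgue_measure.-integrable D (EFin \o f).
  move=> mD fc; apply/integrableP; split; first exact: mfE.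
  rewrite (_ : integral _ _ _ = c%:E) ?ltry// -fc.
  by apply: eq_integral => x _; rewrite /= ger0_norm.
have IQf : lebesgue_measure.-integrable `]-oo, Q] (fun x => ((Q - x) * f x)%:E).
  apply/integrableP; split.
    apply/measurable_EFinP; apply: measurable_funM; first exact: measurable_funB.
    exact: measurable_funTS.
  rewrite (_ : integral _ _ _ = I%:E) ?ltry// -Qf.
  apply: eq_integral => x; rewrite inE/= in_itv/= => xQ.
  by rewrite ger0_norm// mulr_ge0// subr_ge0.
have IfQ := If _ _ (measurable_itv _) (fG Q).
rewrite /profit_expectation.
under eq_integral.
  move=> x _.
  rewrite (_ : _ * f x = (M - C) * Q * f x - (M - V) * ((Q - x) * f x)); last ring.
  over.
rewrite /= integralB_EFin//=; last 2 first.
- exact: (integrableZl _ _ IfQ).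
- exact: (integrableZl _ _ IQf).
under eq_integral do rewrite EFinM.
under [X in (_ - X + _)%E]eq_integral do rewrite EFinM.
under [X in (_ + X)%E]eq_integral do rewrite EFinM.
rewrite !integralZl//; last exact: (If _ (1 - G Q)).
rewrite fG Qf fGQ -!EFinM -EFinB -EFinD; congr (_%:E); ring.
Qed.

(* The tangent inequality at [Q] for the convex function whose derivative
   is [G]. *)
Lemma integral_nondecreasing_tangent {R : realType} (G : R -> R) (Q Q' I I' : R) :
  {homo G : x y / x <= y} -> (forall x, 0 <= G x) ->
  (\int[lebesgue_measure]_(t in `]-oo, Q]) (G t)%:E = I%:E)%E ->
  (\int[lebesgue_measure]_(t in `]-oo, Q']) (G t)%:E = I'%:E)%E ->
  I + G Q * (Q' - Q) <= I'.
Proof.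
move=> ndG G0 GI GI'.
have mG D : measurable D -> measurable_fun D (fun x => (G x)%:E).
  move=> mD; apply/measurable_EFinP; exact: nondecreasing_measurable.
have split_int a b : a <= b ->
    (\int[lebesgue_measure]_(t in `]-oo, b]) (G t)%:E =
     \int[lebesgue_measure]_(t in `]-oo, a]) (G t)%:E +
     \int[lebesgue_measure]_(t in `]a, b]) (G t)%:E)%E.
  move=> ab; rewrite (@itv_bndbnd_setU _ _ _ (BRight a))//=.
  rewrite ge0_integral_setU//=.
  - by apply: mG; exact: measurableU.
  - by move=> x _; rewrite lee_fin.
  - by apply/disj_setPLR => z /=; rewrite !in_itv/= => za; case: ltP za.
have cst_int a b : a <= b ->
    (\int[lebesgue_measure]_(t in `]a, b]) (G Q)%:E = (G Q * (b - a))%:E)%E.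
  move=> ab; rewrite integral_cst//= lebesgue_measure_itv/= lte_fin.
  have [_|ba] := ltP a b; first by rewrite -EFinB -EFinM.
  by rewrite (@le_anti _ _ a b) ?ab ?ba// subrr mulr0 mule0.
(* To the right of [Q], [G] is at least [G Q], so the increment from [I] to [I'] is at least
   [G Q * (Q' - Q)]. *)
have [QQ'|/ltW Q'Q] := leP Q Q'.
  rewrite -lee_fin EFinD -GI -GI' (split_int _ _ QQ') leeD2l//.
  rewrite -cst_int//; apply: ge0_le_integral => //=.
  - by move=> x _; rewrite lee_fin.
  - exact: mG.
  - by move=> x; rewrite in_itv/= => /andP[/ltW Qx _]; rewrite lee_fin ndG.
(* To the left of [Q], [G] is at most [G Q], so the loss from [I] to [I'] is at most
   [G Q * (Q - Q')]. *)
rewrite -(opprB Q) mulrN lerBlDr -lee_fin EFinD -GI -GI' (split_int _ _ Q'Q) leeD2l//.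
rewrite -cst_int//; apply: ge0_le_integral => //=.
- by move=> x _; rewrite lee_fin.
- exact: mG.
- by move=> x; rewrite in_itv/= => /andP[_ xQ]; rewrite lee_fin ndG.
Qed.

(** * Quantiles of a continuous distribution function *)

(** The limits 0 and 1 at the two infinities and the intermediate value theorem give a preimage of
    [y], so [xget] returns a solution and not its default value. *)
Lemma cdf_inv_cdf {d : measure_display} {T : measurableType d} {R : realType}
    (P : probability T R) (X : {RV P >-> R}) (F : R -> R) (y : R) :
  (forall x, cdf X x = (F x)%:E) -> continuous F -> 0 < y < 1 ->
  F (inv_cdf F y) = y.
Proof.
move=> XF cF /andP[y0 y1].
have XFE : cdf X = EFin \o F by apply/funext.
have FN : F x @[x --> -oo] --> (0 : R).
  by have := cvg_cdfNy0 X; rewrite XFE => /fine_cvg.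
have FP : F x @[x --> +oo] --> (1 : R).
  by have := cvg_cdfy1 X; rewrite XFE => /fine_cvg.
have [a Fa] : exists a, F a < y.
  (* The bound holds strictly beyond the threshold [a], hence the shift by 1. *)
  have := cvgr_lt _ FN _ y0; case=> a [_ aP]; exists (a - 1); apply: aP.
  by rewrite ltrBlDr ltrDl.
have [b Fb] : exists b, y < F b.
  have := cvgr_gt _ FP _ y1; case=> b [_ bP]; exists (b + 1); apply: bP.
  by rewrite ltrDl.
have ab : a <= b.
  rewrite leNgt; apply/negP => /ltW/(cdf_nondecreasing X).
  by rewrite !XF lee_fin leNgt (lt_trans Fa).
have [c _ Fc] : exists2 c, c \in `[a, b] & F c = y.
  apply: IVT => //; first exact: continuous_subspaceT.
  by rewrite ge_min (ltW Fa)/= le_max (ltW Fb) orbT.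
by rewrite /inv_cdf; have := @xgetPex _ 0 [set x | F x = y] (ex_intro _ c Fc).
Qed.

(** * The coefficients and the mixed distribution function *)

Section mixture.
Context {R : realType} (p1 p2 p3 p4 : R).
Context (p1_ge0 : 0 <= p1) (p12 : p1 <= p2) (p23 : p2 <= p3)
  (p34 : p3 <= p4) (p4_le1 : p4 <= 1).

Lemma coefP1_ge0 : 0 <= coefP1 p1 p2 p3 p4.
Proof.
have p2_ge0 := le_trans p1_ge0 p12; have p3_ge0 := le_trans p2_ge0 p23.
have p4_ge0 := le_trans p3_ge0 p34.
by rewrite /coefP1 !addr_ge0 // !mulr_ge0.
Qed.

(** On [[0, 1]], [2xy <= x + y]. Summed over the four products with their weights 1/3 and 2/3, this
    bounds them by half of [p1 + p2 + p3 + p4]. *)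
Lemma coefP2_ge0 : 0 <= coefP2 p1 p2 p3 p4.
Proof.
have p2_ge0 := le_trans p1_ge0 p12; have p3_ge0 := le_trans p2_ge0 p23.
have p4_ge0 := le_trans p3_ge0 p34; have p3_le1 := le_trans p34 p4_le1.
have mul_le (x y : R) : 0 <= x -> 0 <= y -> x <= 1 -> y <= 1 -> 2 * (x * y) <= x + y.
  by move=> *; nra.
have p2_le1 := le_trans p23 p3_le1; have p1_le1 := le_trans p12 p2_le1.
rewrite /coefP2.
have h13 := mul_le p1 p3 p1_ge0 p3_ge0 p1_le1 p3_le1.
have h14 := mul_le p1 p4 p1_ge0 p4_ge0 p1_le1 p4_le1.
have h23 := mul_le p2 p3 p2_ge0 p3_ge0 p2_le1 p3_le1.
have h24 := mul_le p2 p4 p2_ge0 p4_ge0 p2_le1 p4_le1.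
lra.
Qed.

(** From [(1 - x)(1 - y) >= 0], [xy >= x + y - 1]; the four weights add up to 2, so the products
    amount to at least [p1 + p2 + p3 + p4 - 2]. *)
Lemma coefP3_ge0 : 0 <= coefP3 p1 p2 p3 p4.
Proof.
have p3_le1 := le_trans p34 p4_le1; have p2_le1 := le_trans p23 p3_le1.
have p1_le1 := le_trans p12 p2_le1.
have mul_ge (x y : R) : x <= 1 -> y <= 1 -> x + y - 1 <= x * y.
  by move=> *; nra.
rewrite /coefP3.
have h13 := mul_ge p1 p3 p1_le1 p3_le1.
have h14 := mul_ge p1 p4 p1_le1 p4_le1.
have h23 := mul_ge p2 p3 p2_le1 p3_le1.
have h24 := mul_ge p2 p4 p2_le1 p4_le1.
lra.
Qed.

Lemma coefP_sum :
  coefP1 p1 p2 p3 p4 + 2 * coefP2 p1 p2 p3 p4 + coefP3 p1 p2 p3 p4 = 2.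
Proof. by rewrite /coefP1 /coefP2 /coefP3; field. Qed.

Context (F1 F2 : R -> R).
Context (F1_gt0 : forall x, 0 < F1 x) (F1_lt1 : forall x, F1 x < 1)
  (F2_gt0 : forall x, 0 < F2 x) (F2_lt1 : forall x, F2 x < 1).

(** The difference combines three positive quantities with nonnegative coefficients; by [coefP_sum]
    these coefficients cannot all vanish. *)
Lemma mixH_lt_mixJ x : mixH p1 p2 p3 p4 F1 F2 x < mixJ p1 p2 p3 p4 F1 F2 x.
Proof.
have P1 := coefP1_ge0; have P2 := coefP2_ge0; have P3 := coefP3_ge0.
have Ps := coefP_sum; rewrite /mixH /mixJ -subr_gt0.
set A := coefP1 _ _ _ _ in P1 Ps *; set B := coefP2 _ _ _ _ in P2 Ps *.
set D := coefP3 _ _ _ _ in P3 Ps *.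
set a := F1 x; set b := F2 x.
have a0 : 0 < a := F1_gt0 x; have a1 : 0 < 1 - a by rewrite subr_gt0 F1_lt1.
have b0 : 0 < b := F2_gt0 x; have b1 : 0 < 1 - b by rewrite subr_gt0 F2_lt1.
rewrite [ltRHS](_ : _ = A * (a * (1 - a))
  + B * (a * (1 - b) + b * (1 - a)) + D * (b * (1 - b))); last by ring.
have aa : 0 < a * (1 - a) by rewrite mulr_gt0.
have bb : 0 < b * (1 - b) by rewrite mulr_gt0.
have ab : 0 < a * (1 - b) + b * (1 - a) by rewrite addr_gt0// mulr_gt0.
move: (a * _) (b * (1 - b)) (_ + b * _) aa bb ab => u v w u0 v0 w0.
rewrite lt0r !addr_ge0 ?mulr_ge0 ?(ltW u0) ?(ltW v0) ?(ltW w0)//= andbT.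
rewrite !paddr_eq0 ?addr_ge0 ?mulr_ge0 ?(ltW u0) ?(ltW v0) ?(ltW w0)//.
rewrite !mulf_eq0 (gt_eqF u0) (gt_eqF v0) (gt_eqF w0) !orbF.
apply/negP => /andP[/andP[/eqP A0 /eqP B0] /eqP D0].
by move: Ps; rewrite A0 B0 D0; lra.
Qed.

Lemma mixF_decreasing x : {homo (fun b => mixF p1 p2 p3 p4 F1 F2 b x) :
  b1 b2 / b1 < b2 >-> b2 < b1}.
Proof. by move=> b1 b2 b12; rewrite /mixF; have := mixH_lt_mixJ x; nra. Qed.

(** A crude bound used for integrability at minus infinity: the left side is at most
    [J - H / 2 <= J], and in [J] the weights [P1 + P2] of [F1] and [P2 + P3] of [F2] are at most
    2. *)
Lemma mixF_le beta x : 0 <= beta ->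
  mixF p1 p2 p3 p4 F1 F2 beta x <= 2 * F1 x + 2 * F2 x.
Proof.
move=> beta0; have := mixH_lt_mixJ x; rewrite /mixF.
have : 0 <= mixH p1 p2 p3 p4 F1 F2 x.
  by rewrite /mixH !addr_ge0 // ?mulr_ge0 ?coefP1_ge0 ?coefP2_ge0 ?coefP3_ge0
    ?sqr_ge0 ?(ltW (F1_gt0 x)) ?(ltW (F2_gt0 x)).
have : mixJ p1 p2 p3 p4 F1 F2 x <= 2 * F1 x + 2 * F2 x.
  have P1 := coefP1_ge0; have P2 := coefP2_ge0; have P3 := coefP3_ge0.
  have Ps := coefP_sum; have := F1_gt0 x; have := F2_gt0 x.
  by rewrite /mixJ; nra.
nra.
Qed.

Lemma continuous_mixF beta : continuous F1 -> continuous F2 ->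
  continuous (mixF p1 p2 p3 p4 F1 F2 beta).
Proof.
move=> c1 c2 x.
have c1x : F1 y @[y --> x] --> F1 x := c1 x.
have c2x : F2 y @[y --> x] --> F2 x := c2 x.
have cH : mixH p1 p2 p3 p4 F1 F2 y @[y --> x] --> mixH p1 p2 p3 p4 F1 F2 x.
  apply: cvgD; first apply: cvgD.
  - exact: (cvgM (cvg_cst _) (cvgM c1x c1x)).
  - exact: (cvgM (cvgM (cvg_cst _) c1x) c2x).
  - exact: (cvgM (cvg_cst _) (cvgM c2x c2x)).
have cJ : mixJ p1 p2 p3 p4 F1 F2 y @[y --> x] --> mixJ p1 p2 p3 p4 F1 F2 x.
  apply: cvgD; first apply: cvgD.
  - exact: (cvgM (cvg_cst _) c1x).
  - exact: (cvgM (cvg_cst _) (cvgD c1x c2x)).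
  - exact: (cvgM (cvg_cst _) c2x).
exact: (cvgD (cvgM cH (cvg_cst _)) (cvgM (cvg_cst _) (cvgB cJ cH))).
Qed.

End mixture.

(** * Strict increase of the optimal expected profit in the risk factor *)

Theorem proposition4p3 (R : realType)
    (V C M : R) (hVC : V < C) (hCM : C < M)
    (p1 p2 p3 p4 : R) (hp1 : 0 <= p1) (hp12 : p1 <= p2) (hp23 : p2 <= p3)
    (hp34 : p3 <= p4) (hp4 : p4 <= 1)
    (mu1 mu2 sigma1 sigma2 : R) (hsigma1 : 0 < sigma1) (hsigma2 : 0 < sigma2)
    (F : R -> R -> R)
    (hF : F = mixF p1 p2 p3 p4 (normal_cdf mu1 sigma1) (normal_cdf mu2 sigma2))
    (d : R -> measure_display) (Omega : forall beta : R, measurableType (d beta))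
    (P : forall beta : R, probability (Omega beta) R)
    (X : forall beta : R, {RV (P beta) >-> R})
    (hX : forall beta : R, 0 <= beta <= 1 ->
       forall x : R, cdf (X beta) x = (F beta x)%:E)
    (f : R -> R -> R)
    (hf : forall beta : R, 0 <= beta <= 1 -> is_density (X beta) (f beta))
    (Qstar : R -> R)
    (hQ : forall beta : R, 0 <= beta <= 1 ->
       Qstar beta = inv_cdf (F beta) ((M - C) / (M - V))) :
  forall beta1 beta2 : R, 0 <= beta1 -> beta1 < beta2 -> beta2 <= 1 ->
    (profit_expectation C M V (f beta1) (Qstar beta1)
     < profit_expectation C M V (f beta2) (Qstar beta2))%E.
Proof.
move=> b1 b2 b1_ge0 b12 b2_le1.
have b1P : 0 <= b1 <= 1 by rewrite b1_ge0 (le_trans (ltW b12)).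
have b2P : 0 <= b2 <= 1 by rewrite b2_le1 (le_trans b1_ge0 (ltW b12)).
have F1_gt0 x := normal_cdf_gt0 mu1 sigma1 x hsigma1.
have F2_gt0 x := normal_cdf_gt0 mu2 sigma2 x hsigma2.
have F1_lt1 x := normal_cdf_lt1 mu1 sigma1 x hsigma1.
have F2_lt1 x := normal_cdf_lt1 mu2 sigma2 x hsigma2.
have cF beta : continuous (F beta).
  by rewrite hF; apply: continuous_mixF; exact: continuous_normal_cdf.
have F_ge0 beta x : 0 <= beta <= 1 -> 0 <= F beta x.
  by move=> /hX/(_ x) XF; rewrite -lee_fin -XF cdf_ge0.
have ndF beta : 0 <= beta <= 1 -> {homo F beta : x y / x <= y}.
  by move=> /hX XF x y /(cdf_nondecreasing (X beta)); rewrite !XF lee_fin.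
have mF beta : measurable_fun setT (F beta).
  exact: continuous_measurable_fun.
have F_int beta Q : 0 <= beta <= 1 -> exists I : R,
    (\int[lebesgue_measure]_(t in `]-oo, Q]) (F beta t)%:E = I%:E)%E.
  move=> betaP; suff : (\int[lebesgue_measure]_(t in `]-oo, Q]) (F beta t)%:E
      \is a fin_num)%E by move=> /fineK <-; eexists.
  rewrite ge0_fin_numE; last by apply: integral_ge0 => x _; rewrite lee_fin F_ge0.
  apply: (@le_lt_trans _ _ (\int[lebesgue_measure]_(t in `]-oo, Q])
    (2%:E * (normal_cdf mu1 sigma1 t)%:E + 2%:E * (normal_cdf mu2 sigma2 t)%:E))%E).
    apply: ge0_le_integral => //=.
    - by move=> x _; rewrite lee_fin F_ge0.
    - apply/measurable_EFinP/measurable_funTS; exact: mF.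
    - apply/measurable_EFinP/measurable_funTS.
      apply: measurable_funD; apply: measurable_funM => //;
        exact: measurable_normal_cdf.
    - move=> x _; rewrite -!EFinM -EFinD lee_fin hF.
      by apply: mixF_le => //; case/andP: betaP.
  have mcdf (m s : R) : 0 < s -> measurable_fun `]-oo, Q]
      (fun t => (normal_cdf m s t)%:E).
    move=> s0; apply/measurable_EFinP/measurable_funTS.
    exact: measurable_normal_cdf.
  have cdf0 (m s x : R) : (0 <= (normal_cdf m s x)%:E)%E.
    by rewrite lee_fin fine_ge0 ?measure_ge0.
  rewrite ge0_integralD//=; last 4 first.
  - by move=> x _; rewrite mule_ge0.
  - by apply: measurable_funeM; exact: mcdf.
  - by move=> x _; rewrite mule_ge0.
  - by apply: measurable_funeM; exact: mcdf.
  rewrite !ge0_integralZl_EFin//; last 2 first.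
  - exact: mcdf.
  - exact: mcdf.
  by rewrite lte_add_pinfty// lte_mul_pinfty// integral_normal_cdf_lty.
have profitE beta Q I : 0 <= beta <= 1 ->
    (\int[lebesgue_measure]_(t in `]-oo, Q]) (F beta t)%:E = I%:E)%E ->
    profit_expectation C M V (f beta) Q = ((M - C) * Q - (M - V) * I)%:E.
  move=> betaP; have [mf f0 fP] := hf _ betaP.
  have XF := hX _ betaP.
  have fF t : (\int[lebesgue_measure]_(x in `]-oo, t]) (f beta x)%:E =
      (F beta t)%:E)%E.
    by rewrite -XF; symmetry; apply: fP.
  (* The upper tail is the complementary distribution function of [X beta]. *)
  have fcF : (\int[lebesgue_measure]_(x in `]Q, +oo[) (f beta x)%:E =
      (1 - F beta Q)%:E)%E.
    rewrite -fP//; have := cdf_ccdf_1 (X beta) Q.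
    rewrite XF /ccdf => h; apply/eqP; rewrite EFinB eq_sym.
    by rewrite sube_eq// ?fin_num_adde_defl// addeC eq_sym; apply/eqP.
  exact: profit_expectationE mf f0 fF fcF.
have hVM := lt_trans hVC hCM.
have MV : 0 < M - V by rewrite subr_gt0.
have c01 : 0 < (M - C) / (M - V) < 1.
  rewrite divr_gt0 ?subr_gt0//= ltr_pdivrMr// mul1r.
  by rewrite ltrD2l ltrN2.
have Qc : F b2 (Qstar b2) = (M - C) / (M - V).
  by rewrite hQ//; exact: (cdf_inv_cdf _ (X b2) _ _ (hX b2 b2P) (cF b2) c01).
have [I1 I1E] := F_int b1 (Qstar b1) b1P.
have [I2 I2E] := F_int b2 (Qstar b2) b2P.
(* The mixed term, risk factor [b2] at the quantity optimal for [b1], is the middle of the chain of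
   inequalities. *)
have [I21 I21E] := F_int b2 (Qstar b1) b2P.
rewrite (profitE _ _ _ b1P I1E) (profitE _ _ _ b2P I2E) lte_fin.
have I21_lt : I21 < I1.
  rewrite -lte_fin -I1E -I21E; apply: ge0_lt_integral => //=.
  - by apply: measurable_funTS; exact: mF.
  - by apply: measurable_funTS; exact: mF.
  - move=> x _; rewrite F_ge0//= hF.
    by apply: mixF_decreasing.
  - by rewrite lebesgue_measure_itv/= ltNyr addey.
  - by rewrite I21E ltry.
(* The tangent at [Qstar b2] is compared with the integral at [Qstar b1]; after multiplication by
   [M - V] its slope is [M - C], which expresses the optimality of [Qstar b2]. *)
have := integral_nondecreasing_tangent _ _ _ _ _ (ndF _ b2P)
  (fun x => F_ge0 _ x b2P) I2E I21E.
rewrite Qc => /(ler_wpM2l (ltW MV)).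
rewrite mulrDr mulrA (mulrC (M - V) (_ / _)) divfK ?gt_eqF// => tangent.
have : (M - V) * I21 < (M - V) * I1 by rewrite ltr_pM2l.
lra.
Qed.
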